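(* Let $k$ be a field, let $R$ be a $k$-algebra, and let $A=R[\mathcal{S},\mathcal{D};\sigma,\delta]$ be a differential difference algebra of type $(m,n)$ over $R$, $m,n\ge 1$. Then $$\operatorname{GKdim}(A)\geq\operatorname{GKdim}(R)+m+n.$$
   Context: All algebras are unital associative $k$-algebras, $k$ a field. For a subspace $V$ of an algebra, $V^r$ is the $k$-span of all products of $r$ elements of $V$. The Gelfand-Kirillov dimension of a $k$-algebra $A$ is $\operatorname{GKdim}(A)=\sup_V\limsup_{r\to\infty}\log_r\dim_k(V^r)$, the supremum over all finite dimensional subspaces $V$ of $A$ (it may be $\infty$). A derivation on $R$ is a $k$-linear map $\delta:R\to R$ with $\delta(ab)=a\delta(b)+\delta(a)b$. Definition. An algebra $A$ is a differential difference algebra of type $(m,n)$, $m,n\geq 1$, over a subalgebra $R\subseteq A$, written $A=R[\mathcal{S},\mathcal{D};\sigma,\delta]$, if there exist elements $S_1,\ldots,S_m,D_1,\ldots,D_n$ in $A$ such that: (i) the set $\{S_1^{\alpha_1}\cdots S_m^{\alpha_m}D_1^{\beta_1}\cdots D_n^{\beta_n}:\alpha\in\mathbb{N}^m,\beta\in\mathbb{N}^n\}$ (with $0\in\mathbb{N}$) is a basis of $A$ as a free left $R$-module; (ii) $D_ir=rD_i+\delta_i(r)$ for $1\leq i\leq n$, $r\in R$, where $\delta_i$ is a derivation on $R$; (iii) $S_ir=\sigma_i(r)S_i$ for $1\leq i\leq m$, $r\in R$, where $\sigma_i$ is a $k$-algebra automorphism of the subalgebra $R[D_1,\ldots,D_n]\subseteq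 A$ (generated by $R$ and $D_1,\dots,D_n$) such that $\sigma_i|_R$ is an automorphism of $R$ and $\sigma_i(D_j)=\sum_{l=1}^n a_{ijl}D_l$ with $a_{ijl}\in R$; (iv) $S_iS_j=S_jS_i$ for $1\leq i,j\leq m$, and $D_iD_j=D_jD_i$ for $1\leq i,j\leq n$; (v) $D_iS_j=S_j\sigma_j(D_i)$ for $1\leq i\leq n$, $1\leq j\leq m$; (vi) $\delta_i\circ\delta_j=\delta_j\circ\delta_i$ for $1\le i,j\le n$ and $\sigma_{i}\circ\sigma_{j}=\sigma_{j}\circ\sigma_{i}$ for $1\le i,j\le m$. *)

(* Defs.v *)
From HB Require Import structures.
From mathcomp Require Import all_boot all_order all_algebra.
From mathcomp Require Import all_classical all_reals all_analysis.

Set Implicit Arguments.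
Unset Strict Implicit.
Unset Printing Implicit Defensive.

Import Order.TTheory GRing.Theory Num.Theory.

Local Open Scope classical_set_scope.
Local Open Scope ring_scope.

Section LinearAlgebra.
Variables (k : fieldType) (E : lmodType k).

Definition lin_span (X : set E) : set E :=
  smallest [set V : set E | submod_closed [in V]] X.

Definition lin_indep (d : nat) (v : 'I_d -> E) : Prop :=
  forall c : 'I_d -> k, \sum_(i < d) c i *: v i = 0 -> forall i, c i = 0.

(* [has_dim V d]: V is a subspace with a basis of d vectors. *)
Definition has_dim (V : set E) (d : nat) : Prop :=
  exists v : 'I_d -> E, lin_indep v /\ V = lin_span (range v).

Definition fin_dim (V : set E) : Prop := exists d, has_dim V d.

(* The default value 0 is only taken when V is not [fin_dim]. *)
Definition subspace_dim (V : set E) : nat := xget 0%N [set d | has_dim V d].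

End LinearAlgebra.

Section GelfandKirillov.
Variables (k : fieldType) (A : algType k).

Definition subspace_pow (V : set A) (r : nat) : set A :=
  lin_span [set x | exists2 v : 'I_r -> A,
                      (forall i, V (v i)) & x = \prod_(i < r) v i].

(* The conventions ln 0 = 0 (when V ^ r = 0) and x / 0 = 0 (when r <= 1, as
   ln 0 = ln 1 = 0) do not affect the result: the latter concerns two terms
   only, and A is nontrivial (every [algType] is), so that V = k.1 already
   contributes 0 to the supremum. *)
Definition GKdim (K : realType) : \bar K :=
  ereal_sup [set limn_esup (fun r : nat =>
                   (ln ((subspace_dim (subspace_pow V r))%:R : K) / ln r%:R)%:E)
            | V in [set V : set A | fin_dim V]].

Definition subalg_gen (X : set A) : set A :=
  smallest [set B : set A | subalg_closed [in B]] X.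

(* The values of f outside B are irrelevant. *)
Definition alg_automorphism_on (B : set A) (f : A -> A) : Prop :=
  [/\ set_bij B B f,
      f 1 = 1,
      (forall (c : k) x y, B x -> B y -> f (c *: x + y) = c *: f x + f y)
    & (forall x y, B x -> B y -> f (x * y) = f x * f y)].

End GelfandKirillov.

Section DifferentialDifferenceAlgebra.
Variables (k : fieldType) (A : algType k) (P : pred A) (R : subAlgType P).

(* The R-action on A is left multiplication by [val r]. *)
Definition free_left_basis (I : eqType) (e : I -> A) : Prop :=
  (forall a : A, exists (s : seq I) (c : I -> R),
      a = \sum_(i <- s) val (c i) * e i) /\
  (forall (s : seq I) (c : I -> R), uniq s ->
      \sum_(i <- s) val (c i) * e i = 0 -> forall i, i \in s -> c i = 0).

Definition derivation (d : R -> R) : Prop :=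
  linear d /\ forall a b, d (a * b) = a * d b + d a * b.

Variables (m n : nat).

Definition monomial (S : 'I_m -> A) (D : 'I_n -> A)
    (ab : {ffun 'I_m -> nat} * {ffun 'I_n -> nat}) : A :=
  (\prod_(i < m) S i ^+ ab.1 i) * (\prod_(j < n) D j ^+ ab.2 j).

Definition poly_subalg (D : 'I_n -> A) : set A :=
  subalg_gen (range (val : R -> A) `|` range D).

Record diff_diff_algebra (S : 'I_m -> A) (D : 'I_n -> A)
    (sigma : 'I_m -> A -> A) (delta : 'I_n -> R -> R) : Prop := {
  dda_basis : free_left_basis (monomial S D);
  dda_delta : forall i, derivation (delta i);
  dda_D_coef : forall i (r : R),
    D i * val r = val r * D i + val (delta i r);
  dda_sigma : forall i, alg_automorphism_on (poly_subalg D) (sigma i);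
  dda_sigma_R : forall i,
    alg_automorphism_on (range (val : R -> A)) (sigma i);
  dda_sigma_D : exists a : 'I_m -> 'I_n -> 'I_n -> R, forall i j,
    sigma i (D j) = \sum_(l < n) val (a i j l) * D l;
  dda_S_coef : forall i (r : R), S i * val r = sigma i (val r) * S i;
  dda_S_comm : forall i j, S i * S j = S j * S i;
  dda_D_comm : forall i j, D i * D j = D j * D i;
  dda_D_S : forall i j, D i * S j = S j * sigma j (D i);
  dda_delta_comm : forall i j, delta i \o delta j =1 delta j \o delta i;
  dda_sigma_comm : forall i j x, poly_subalg D x ->
    sigma i (sigma j x) = sigma j (sigma i x)
}.

End DifferentialDifferenceAlgebra.

(* Main.v *)
(** Let W be a finite dimensional subspace of R and V the span of W, 1, the S_i
    and the D_j.  For N = m + n + 1, the power V ^ (N r) contains all products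
    w S^a D^b with w in W ^ r and all exponents a_i, b_j < r; by freeness of A
    over R, dim V ^ (N r) >= dim W ^ r * r ^ (m + n).  Replacing r by N r does
    not change logarithmic growth rates, since ln (N r) / ln r tends to 1. *)
Require Import Defs.
From mathcomp Require Import all_boot all_order all_algebra.
From mathcomp Require Import all_classical all_reals all_analysis.
From mathcomp Require Import lra.

Set Implicit Arguments.
Unset Strict Implicit.
Unset Printing Implicit Defensive.

Import Order.TTheory GRing.Theory Num.Theory.

Local Open Scope classical_set_scope.
Local Open Scope ring_scope.

(** * Spans, independent families and dimension *)

Section LinearAlgebra.
Variables (k : fieldType) (E : lmodType k).
Implicit Types (X Y V : set E).

Lemma submod_closed_setP V :
  submod_closed [in V] <->
  V 0 /\ forall a x y, V x -> V y -> V (a *: x + y).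
Proof.
split=> [[V0 VD]|[V0 VD]]; split.
- by have := V0; rewrite inE.
- by move=> a x y Vx Vy; have := VD a x y; rewrite !inE; exact.
- by rewrite inE.
- by move=> a x y; rewrite !inE; exact: VD.
Qed.

Lemma lin_span0 X : lin_span X 0.
Proof. by move=> V [/submod_closed_setP[]]. Qed.

Lemma lin_span_linear X a x y :
  lin_span X x -> lin_span X y -> lin_span X (a *: x + y).
Proof.
move=> Xx Xy V [/[dup] /submod_closed_setP[_ VD] Vc XV].
by apply: VD; [exact: Xx | exact: Xy].
Qed.

Lemma lin_span_sub X Y : X `<=` lin_span Y -> lin_span X `<=` lin_span Y.
Proof.
apply: smallest_sub; apply/submod_closed_setP.
by split; [exact: lin_span0 | exact: lin_span_linear].
Qed.

Lemma sub_lin_span X : X `<=` lin_span X.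
Proof. exact: sub_gen_smallest. Qed.

Lemma lin_span_sum X (I : finType) (c : I -> k) (x : I -> E) :
  (forall i, lin_span X (x i)) -> lin_span X (\sum_i c i *: x i).
Proof.
move=> Xx; elim/big_ind : _ => [|u v Xu Xv|i _]; first exact: lin_span0.
- by rewrite -[u]scale1r; exact: lin_span_linear.
- by rewrite -[_ *: _]addr0; apply: lin_span_linear; [|exact: lin_span0].
Qed.

Lemma lin_span_range (I : finType) (f : I -> E) x :
  lin_span (range f) x -> exists c : I -> k, x = \sum_i c i *: f i.
Proof.
apply: (@smallest_sub _ _ _ [set y | exists c : I -> k, y = \sum_i c i *: f i]).
  apply/submod_closed_setP; split=> [|a _ _ [c ->] [c' ->]].
    by exists (fun=> 0); rewrite big1// => i _; rewrite scale0r.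
  exists (fun i => a * c i + c' i); rewrite scaler_sumr -big_split/=.
  by apply: eq_bigr => i _; rewrite scalerDl scalerA.
move=> _ [i _ <-]; exists (fun j => (j == i)%:R).
rewrite (bigD1 i)//= eqxx scale1r big1 ?addr0// => j /negPf ->.
by rewrite scale0r.
Qed.

(** The coefficients of the [v i] over [w] form a [d] by [e] matrix. Independence of [v] makes its
    rows independent, so its rank is [d], which is bounded by the number of columns. *)
Lemma lin_indep_leq d e (v : 'I_d -> E) (w : 'I_e -> E) :
  lin_indep v -> (forall i, lin_span (range w) (v i)) -> (d <= e)%N.
Proof.
move=> v_free /(_ _)/lin_span_range vw.
have [c vE] := choice vw.
pose M := \matrix_(i < d, j < e) c i j.
suff /eqP <- : row_free M by exact: rank_leq_col.
apply: inj_row_free => u uM0; apply/rowP => i; rewrite mxE.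
apply: (v_free (u 0)); under eq_bigr do rewrite vE scaler_sumr.
rewrite exchange_big/= big1// => j _; under eq_bigr do rewrite scalerA.
rewrite -scaler_suml; have /rowP/(_ j) := uM0; rewrite !mxE.
under eq_bigr do rewrite mxE.
by move=> ->; rewrite scale0r.
Qed.

Lemma fin_dim_span_ord d (v : 'I_d -> E) : fin_dim (lin_span (range v)).
Proof.
elim: d v => [|d IHd] v; first by exists 0%N, v; split=> // c _ [].
have [v_free|] := pselect (lin_indep v); first by exists d.+1, v.
move=> /existsNP[c] /not_implyP[c0 /existsNP[i /eqP ci_neq0]].
suff -> : lin_span (range v) = lin_span (range (v \o lift i)) by exact: IHd.
apply/seteqP; split; apply: lin_span_sub => _ [j _ <-]; last first.
  by apply: sub_lin_span; exists (lift i j).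
have [j' ->|->] := unliftP i j; first by apply: sub_lin_span; exists j'.
suff -> : v i = \sum_j (- (c i)^-1 * c (lift i j)) *: v (lift i j).
  by apply: lin_span_sum => l; apply: sub_lin_span; exists l.
under eq_bigr do rewrite -scalerA.
rewrite -scaler_sumr; apply: (scalerI ci_neq0).
rewrite scalerA mulrN divff// scaleN1r.
apply/eqP; rewrite -addr_eq0; apply/eqP; rewrite -[RHS]c0.
by rewrite (bigD1_ord i).
Qed.

Lemma fin_dim_span (I : finType) (f : I -> E) : fin_dim (lin_span (range f)).
Proof.
suff -> : range f = range (f \o @enum_val I predT) by exact: fin_dim_span_ord.
apply/seteqP; split=> _ [i _ <-]; last by exists (enum_val i).
by exists (enum_rank i) => //=; rewrite enum_rankK.
Qed.

(** A positive value cannot be the default 0 of [xget], so it comes from an actual basis. *)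
Lemma subspace_dim_gt0 V :
  (0 < subspace_dim V)%N -> has_dim V (subspace_dim V).
Proof. by rewrite /subspace_dim; case: xgetP. Qed.

Lemma subspace_dim_ge V d (v : 'I_d -> E) :
  fin_dim V -> lin_indep v -> (forall i, V (v i)) -> (d <= subspace_dim V)%N.
Proof.
move=> /(xgetPex 0%N)[w [_ VE]] v_free Vv.
by apply: (lin_indep_leq (w := w) v_free) => i; rewrite -VE.
Qed.

End LinearAlgebra.

(** * Powers of a subspace *)

Section Powers.
Variables (k : fieldType) (A : algType k).
Implicit Types V : set A.

(** Membership of the product is linear in each factor separately, so both factors may be taken to
    be products of elements of [V], which are then concatenated. *)
Lemma subspace_powM V r s x y :
  subspace_pow V r x -> subspace_pow V s y -> subspace_pow V (r + s) (x * y).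
Proof.
move=> Vx Vy.
apply: (@smallest_sub _ _ _ [set z | subspace_pow V (r + s) (z * y)]) Vx.
  apply/submod_closed_setP; split=> [|a u v /= Vu Vv].
    by rewrite /= mul0r; exact: lin_span0.
  by rewrite mulrDl -scalerAl; exact: lin_span_linear.
move=> _ [v Vv ->].
apply: (@smallest_sub _ _ _
  [set z | subspace_pow V (r + s) (\prod_(i < r) v i * z)]) Vy.
  apply/submod_closed_setP; split=> [|a u u' /= Vu Vu'].
    by rewrite /= mulr0; exact: lin_span0.
  by rewrite mulrDr -scalerAr; exact: lin_span_linear.
move=> _ [w Vw ->]; apply: sub_lin_span.
exists (fun i => match fintype.split i with inl j => v j | inr j => w j end).
  by move=> i; case: fintype.split.
rewrite big_split_ord/=; congr (_ * _); apply: eq_bigr => i _.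
  by rewrite (unsplitK (inl i : 'I_r + 'I_s)).
by rewrite (unsplitK (inr i : 'I_r + 'I_s)).
Qed.

Lemma subspace_powX V r x : V x -> subspace_pow V r (x ^+ r).
Proof.
move=> Vx; apply: sub_lin_span; exists (fun=> x) => //.
by rewrite prodr_const card_ord.
Qed.

Lemma subspace_pow_le V r s x :
  V 1 -> (r <= s)%N -> subspace_pow V r x -> subspace_pow V s x.
Proof.
move=> V1 rs Vx; rewrite -(subnKC rs) -[x]mulr1; apply: subspace_powM => //.
by rewrite -(expr1n _ (s - r)); exact: subspace_powX.
Qed.

(** Each power [x i ^+ e i] is padded with copies of 1 to exactly [r] factors. *)
Lemma subspace_pow_prodX V r p (x : 'I_p -> A) (e : 'I_p -> nat) :
  V 1 -> (forall i, V (x i)) -> (forall i, e i <= r)%N ->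
  subspace_pow V (p * r) (\prod_(i < p) x i ^+ e i).
Proof.
move=> V1; elim: p x e => [|p IHp] x e Vx er.
  by rewrite big_ord0 -(expr0 1); exact: subspace_powX.
rewrite big_ord_recl mulSn; apply: subspace_powM; last exact: IHp.
by apply: (subspace_pow_le V1 (er ord0)); exact: subspace_powX.
Qed.

(** By distributivity, the power is spanned by the products of generators, one for each of the
    finitely many maps from ['I_r] to [I]. *)
Lemma fin_dim_subspace_pow (I : finType) (f : I -> A) r :
  fin_dim (subspace_pow (lin_span (range f)) r).
Proof.
suff -> : subspace_pow (lin_span (range f)) r =
    lin_span (range (fun h : {ffun 'I_r -> I} => \prod_i f (h i))).
  exact: fin_dim_span.
apply/seteqP; split; apply: lin_span_sub.
  move=> _ [v /(_ _)/lin_span_range Vv ->]; have [c vE] := choice Vv.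
  under eq_bigr do rewrite vE.
  rewrite bigA_distr_bigA; under eq_bigr do rewrite scaler_prod.
  by apply: lin_span_sum => h; apply: sub_lin_span; exists h.
move=> _ [h _ <-]; apply: sub_lin_span; exists (fun i => f (h i)) => // i.
by apply: sub_lin_span; exists (h i).
Qed.

End Powers.

(** * Transfer from the subalgebra [R] to [A] *)

Section Subalgebra.
Variables (k : fieldType) (A : algType k) (P : pred A) (R : subAlgType P).

Lemma subspace_pow_val (W : set R) (V : set A) r x :
  (forall w, W w -> V (val w)) ->
  subspace_pow W r x -> subspace_pow V r (val x).
Proof.
move=> WV; apply: (@smallest_sub _ _ _ [set z : R | subspace_pow V r (val z)]).
  apply/submod_closed_setP; split=> [|a u v /= Vu Vv].
    by rewrite /= raddf0; exact: lin_span0.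
  by rewrite linearP; exact: lin_span_linear.
move=> _ [v Wv ->]; rewrite /= rmorph_prod; apply: sub_lin_span.
by exists (fun i => val (v i)) => // i; exact: WV.
Qed.

(** As for bases in a tower of field extensions: freeness over [R] kills the total coefficient of
    each [e (g j)], a [k]-combination of the [u i], and independence of [u] then kills its
    scalars. *)
Lemma free_left_basis_indep (I : eqType) (e : I -> A) (J : finType)
    (g : J -> I) d (u : 'I_d -> R) :
  free_left_basis R e -> injective g -> lin_indep u ->
  lin_indep (fun l : 'I_#|{: 'I_d * J}| =>
    val (u (enum_val l).1) * e (g (enum_val l).2)).
Proof.
move=> [_ e_free] g_inj u_free c c0.
pose b (i : 'I_d) (j : J) := c (enum_rank (i, j)).
have b0 : \sum_j val (\sum_i b i j *: u i) * e (g j) = 0.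
  rewrite -[RHS]c0; under eq_bigr do rewrite linear_sum mulr_suml.
  rewrite exchange_big/=.
  rewrite (pair_bigA _ (fun i j => val (b i j *: u i) * e (g j)))/=.
  rewrite (reindex (@enum_val _ predT)) /=; last exact/onW_bij/enum_val_bij.
  apply: eq_bigr => l _; rewrite /b -surjective_pairing enum_valK.
  by rewrite linearZ/= scalerAl.
(* Freeness speaks of coefficient functions on all of [I], so the coefficients are extended by 0
   outside the image of [g]; injectivity of [g] gives the right value on the image. *)
pose h i := if [pick j | g j == i] is Some j then \sum_i b i j *: u i else 0.
have hg j : h (g j) = \sum_i b i j *: u i.
  rewrite /h; case: pickP => [j' /eqP/g_inj ->//|/(_ j)].
  by rewrite eqxx.
move=> l; have := e_free (map g (enum J)) h.
rewrite map_inj_uniq ?enum_uniq// big_map big_enum/=.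
under eq_bigr do rewrite hg.
move=> /(_ isT b0 (g (enum_val l).2)).
rewrite map_f ?mem_enum// hg => /(_ isT)/u_free/(_ (enum_val l).1).
by rewrite /b -surjective_pairing enum_valK.
Qed.

End Subalgebra.

(** * Upper limits and logarithmic growth *)

Section LogGrowth.
Variable K : realType.
Local Open Scope ereal_scope.

Lemma limn_esup_ge (u : (\bar K)^nat) (x : \bar K) :
  (forall n0, exists2 r, (n0 <= r)%N & x <= u r) -> x <= limn_esup u.
Proof.
move=> ux; apply: le_ereal_inf_tmp => _ [B [n0 _ n0B] <-].
have [r n0r xur] := ux n0.
by apply: le_trans xur _; apply: ereal_sup_ubound; exists r => //; exact: n0B.
Qed.

Lemma limn_esup_gt (u : (\bar K)^nat) (x : \bar K) n0 :
  x < limn_esup u -> exists2 r, (n0 <= r)%N & x < u r.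
Proof.
move=> xu; have : x < ereal_sup [set u r | r in [set r | (n0 <= r)%N]].
  apply: lt_le_trans xu _; apply: ereal_inf_lbound.
  by exists [set r | (n0 <= r)%N] => //; exists n0.
by move=> /ereal_sup_gt[_ [r n0r <-] xur]; exists r.
Qed.

(** Allows estimates on a possibly infinite upper limit to be made with real numbers only: if [x] is
    infinite, [y] exceeds every real. *)
Lemma lee_lt_EFin (x y : \bar K) :
  (forall c : K, c%:E < x -> c%:E <= y) -> x <= y.
Proof.
case: x => [x| |] xy; last exact: leNye.
- by apply/lee_subgt0Pr => e e0; apply: xy; rewrite lte_fin ltrBlDr ltrDl.
- by have /eqyP -> : forall c : K, (0 < c)%R -> c%:E <= y
    by move=> c _; apply: xy; rewrite ltry.
Qed.

(* The maximum with 1 absorbs the convention [ln 0 = 0]. *)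
Lemma limn_esup_log_growth (p N : nat) (d e : nat -> nat) :
  (0 < N)%N -> (forall r, maxn 1 (d r) * r ^ p <= e (N * r))%N ->
  limn_esup (fun r => (ln (d r)%:R / ln r%:R : K)%:E) + p%:R%:E <=
  limn_esup (fun r => (ln (e r)%:R / ln r%:R : K)%:E).
Proof.
move=> N0 de; rewrite -leeBrDr//; apply: lee_lt_EFin => c ltc.
rewrite leeBrDr// -EFinD; apply/lee_subgt0Pr => eps eps0.
apply: limn_esup_ge => n0.
(* Beyond this threshold [(c + p - eps) * ln N <= eps * ln r]: passing from [r] to [N * r] costs at
   most [eps] in the exponent. *)
have [n1 _ n1P] := nbhs_infty_ger (expR ((c + p%:R - eps) * ln N%:R / eps)).
(* The bound 2 makes [ln r] positive. *)
have [r] := limn_esup_gt (maxn (maxn n0 2) n1) ltc.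
rewrite !geq_max -andbA => /and3P[n0r r2 /n1P/= rN].
have r0 : (0 < r%:R :> K)%R by rewrite ltr0n ltnW.
have N0K : (0 < N%:R :> K)%R by rewrite ltr0n.
have lr0 : (0 < ln r%:R :> K)%R by rewrite ln_gt0// ltr1n.
have lN0 : (0 <= ln N%:R :> K)%R by rewrite ln_ge0// ler1n.
rewrite lte_fin ltr_pdivlMr// => cr.
exists (N * r)%N; first by rewrite (leq_trans n0r)// leq_pmull.
rewrite -EFinB lee_fin natrM lnM ?posrE// ler_pdivlMr; last by rewrite ltr_wpDl.
have : (ln ((maxn 1 (d r) * r ^ p)%:R : K) <= ln (e (N * r)%N)%:R)%R.
  rewrite ler_ln ?posrE ?ler_nat ?ltr0n//.
  - by rewrite muln_gt0 leq_max/= expn_gt0 ltnW.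
  - by apply: leq_trans (de r); rewrite muln_gt0 leq_max/= expn_gt0 ltnW.
apply: le_trans.
rewrite natrM lnM ?posrE ?ltr0n ?leq_max ?expn_gt0 ?(ltnW r2)//.
rewrite natrX lnXn// -mulr_natl.
have -> : ln (maxn 1 (d r))%:R = ln (d r)%:R :> K.
  case: (d r) => [|d']; first by rewrite maxn0 ln1 ln0.
  by congr (ln _%:R); exact/maxn_idPr.
have : ((c + p%:R - eps) * ln N%:R <= eps * ln r%:R)%R.
  by rewrite [leRHS]mulrC -ler_pdivrMr// -ler_expR (lnK r0).
(* The chain is [ln d + p * ln r > (c + p) * ln r >= (c + p - eps) * (ln N + ln r)], with [d]
   standing for [d r]. *)
nra.
Qed.

End LogGrowth.

(** * Counting independent monomials in [A] *)

Section Growth.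
Variables (k : fieldType) (A : algType k) (P : pred A) (R : subAlgType P).
Variables (m n : nat) (S : 'I_m -> A) (D : 'I_n -> A).

Lemma monomial_growth (W : set R) (V : set A) r :
  free_left_basis R (monomial S D) ->
  fin_dim (subspace_pow V ((m + n).+1 * r)) ->
  V 1 -> (forall w, W w -> V (val w)) ->
  (forall i, V (S i)) -> (forall j, V (D j)) ->
  (maxn 1 (subspace_dim (subspace_pow W r)) * r ^ (m + n) <=
   subspace_dim (subspace_pow V ((m + n).+1 * r)))%N.
Proof.
move=> basis finV V1 WV VS VD.
have [d [u [u_free Vu ->]]] : exists d (u : 'I_d -> R), [/\ lin_indep u,
    forall i, subspace_pow V r (val (u i)) &
    maxn 1 (subspace_dim (subspace_pow W r)) = d].
  (* If the dimension is 0, genuinely or by default, the single nonzero vector [1] serves as the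
     family, matching the maximum with 1. *)
  have [->|d_gt0] := posnP (subspace_dim (subspace_pow W r)).
    exists 1%N, (fun=> 1); split=> // [c|_].
      rewrite big_ord1 => /eqP; rewrite scaler_eq0 oner_eq0 orbF => /eqP c0 i.
      by rewrite (ord1 i).
    by rewrite rmorph1 -(expr1n _ r); exact: subspace_powX.
  have [u [u_free uE]] := subspace_dim_gt0 d_gt0.
  exists (subspace_dim (subspace_pow W r)), u; split=> // [i|].
    by apply: (subspace_pow_val WV); rewrite uE; apply: sub_lin_span; exists i.
  exact/maxn_idPr.
(* Exponents are taken in ['I_r], which yields exactly [r ^ (m + n)] distinct monomials. *)
pose nat_ffun q (h : {ffun 'I_q -> 'I_r}) := [ffun i => val (h i)].
have nat_ffun_inj q : injective (@nat_ffun q).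
  move=> h h' /ffunP hh'; apply/ffunP => i.
  by have := hh' i; rewrite !ffunE => /val_inj.
pose g (h : {ffun 'I_m -> 'I_r} * {ffun 'I_n -> 'I_r}) :=
  (nat_ffun _ h.1, nat_ffun _ h.2).
have g_inj : injective g.
  by move=> [a b] [a' b'] [/nat_ffun_inj-> /nat_ffun_inj->].
have <- : #|{: 'I_d * ({ffun 'I_m -> 'I_r} * {ffun 'I_n -> 'I_r})}| =
    (d * r ^ (m + n))%N.
  by rewrite !card_prod !card_ffun !card_ord expnD.
have u_indep := free_left_basis_indep basis g_inj u_free.
apply: (subspace_dim_ge finV u_indep) => l.
(* The exponent splits as [r + (m * r + n * r)]: [r] factors for the element of [R] and [r] for each
   [S i] and each [D j]. *)
rewrite mulSn mulnDl; apply: subspace_powM; first exact: Vu.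
by apply: subspace_powM; apply: subspace_pow_prodX => // i;
  rewrite ffunE; exact/ltnW/ltn_ord.
Qed.

End Growth.

(** * Passage to the supremum over finite dimensional subspaces *)

Theorem proposition3p2 (K : realType) (k : fieldType) (A : algType k)
    (P : pred A) (R : subAlgType P) (m n : nat)
    (S : 'I_m -> A) (D : 'I_n -> A)
    (sigma : 'I_m -> A -> A) (delta : 'I_n -> R -> R)
    (hm : (1 <= m)%N) (hn : (1 <= n)%N)
    (hA : diff_diff_algebra S D sigma delta) :
  (GKdim R K + (m%:R)%:E + (n%:R)%:E <= GKdim A K)%E.
Proof.
(* The finite number [m + n] is moved to the right, so that the supremum defining [GKdim R K] can be
   bounded one [W] at a time. *)
rewrite -addeA -EFinD -natrD -leeBrDr//.
apply: ge_ereal_sup => _ [W [d [w [_ WE]]] <-].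
rewrite leeBrDr//.
(* A finite index type for the generators of [V]; [None] stands for 1, which makes the padding of
   shorter products possible. *)
pose f (x : option ('I_d + ('I_m + 'I_n))) : A :=
  match x with
  | None => 1
  | Some (inl i) => val (w i)
  | Some (inr (inl i)) => S i
  | Some (inr (inr j)) => D j
  end.
pose V := lin_span (range f).
have fV x : V (f x) by apply: sub_lin_span; exists x.
have WV x : W x -> V (val x).
  rewrite WE => /lin_span_range[c ->]; rewrite linear_sum.
  under eq_bigr do rewrite linearZ/=.
  by apply: lin_span_sum => i; exact: (fV (Some (inl i))).
have dim_growth r : (maxn 1 (subspace_dim (subspace_pow W r)) * r ^ (m + n) <=
    subspace_dim (subspace_pow V ((m + n).+1 * r)))%N.
  apply: monomial_growth WV _ _.
  - exact: dda_basis hA.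
  - exact: fin_dim_subspace_pow.
  - exact: (fV None).
  - by move=> i; exact: (fV (Some (inr (inl i)))).
  - by move=> j; exact: (fV (Some (inr (inr j)))).
apply: (le_trans (limn_esup_log_growth K (ltn0Sn (m + n)) dim_growth)).
by apply: ereal_sup_ubound; exists V => //; exact: fin_dim_span.
Qed.
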